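(* Let $P_1,P_2\subset\mathbb{R}^d$ be finite sets with $|P_1|=m$, $|P_2|=n$ such that $P_1\cup P_2$ has diameter $1$, and let $G=(P_1,P_2,E)$ be the bipartite unit distance graph between them. If $G$ is $K_{u,u}$-free, then for every $\varepsilon>0$, writing $s=\lfloor (d+1)/2\rfloor$, \[|E|=O_{d,\varepsilon}\left(u^{\frac{2}{s+1}}(mn)^{\frac{s}{s+1}+\varepsilon}+u\,m^{1+\varepsilon}+u\,n^{1+\varepsilon}\right).\]
   Context: The bipartite unit distance graph between $P_1$ and $P_2$ has vertex classes $P_1,P_2$ and an edge $\{p_1,p_2\}$ ($p_1\in P_1$, $p_2\in P_2$) if and only if $\|p_1-p_2\|=1$. The diameter of a finite set is the maximum distance between two of its points. $K_{u,u}$-free means the graph contains no complete bipartite subgraph with $u$ vertices in each class. *)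

(* Defs.v *)
From HB Require Import structures.
From mathcomp Require Import all_boot all_order all_algebra.
From mathcomp Require Import finmap.
From mathcomp Require Import reals exp.
Set Implicit Arguments. Unset Strict Implicit. Unset Printing Implicit Defensive.
Import Order.TTheory GRing.Theory Num.Theory.
Local Open Scope ring_scope.
Local Open Scope fset_scope.

Section Defs.
Variables (R : realType) (d : nat).
Notation pt := 'rV[R]_d.

Definition edist (p q : pt) : R := Num.sqrt (\sum_(i < d) (p 0 i - q 0 i) ^+ 2).

Definition has_diameter (P : {fset pt}) (D : R) : Prop :=
  (forall p q, p \in P -> q \in P -> edist p q <= D) /\
  (exists p q, [/\ p \in P, q \in P & edist p q = D]).

Definition unit_edges (P1 P2 : {fset pt}) : {fset pt * pt} :=
  [fset pq in P1 `*` P2 | edist pq.1 pq.2 == 1].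

Definition Kuu_free (u : nat) (P1 P2 : {fset pt}) : Prop :=
  ~ exists (A B : {fset pt}),
      [/\ A `<=` P1, B `<=` P2, #|` A| = u, #|` B| = u &
          forall a b, a \in A -> b \in B -> edist a b = 1].
End Defs.

(* Main.v *)
Require Import Defs.
From HB Require Import structures.
From mathcomp Require Import all_boot all_order all_algebra.
From mathcomp Require Import finmap.
From mathcomp Require Import reals exp.
From mathcomp Require Import zify ring lra.
Import Order.TTheory GRing.Theory Num.Theory.
Local Open Scope ring_scope.

(** Lift [q] to [(|q|^2, q)] in dimension [D = d + 1] and turn [p] into the affine
function [1 - |p - q|^2] of the lifted point.  All these functions are
nonnegative on the lifted points, and unit distances are their zeros.  A
constant-size random sample of the functions, together with a bounding box,
cuts out a polytope with [O(r^s)] vertices, [s = D/2 = (d + 1)/2] (each vertex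
is the unique minimum or maximum of a generic functional on a face of
codimension at most [D/2]), such that each vertex violates only few of the
original functions.  Every lifted point is in the hull of at most [2^D]
vertices.  If the function of [p] vanishes at [q], then either it is negative at
one of these vertices, and the edge goes into the subproblem of that vertex, or
it vanishes at all of them, and grouping the points by their vertex sets
exhibits these edges as a bounded number of bicliques.  No simplicial
decomposition of the polytope is needed.  Applying this always to the smaller
side gives a recursion for the number of edges. *)

Set Implicit Arguments.
Unset Strict Implicit.
Unset Printing Implicit Defensive.

(** * Sampling *)

Section Sampling.
Local Open Scope nat_scope.

Definition mapl (X Y B : Type) (f : Y -> X) (u : Y + B) : X + B :=
  match u with inl i => inl (f i) | inr b => inr b end.

(** In the application [Y] consists of the positions in a sample [f], and [B] of constraints that
    are present whatever the sample is. *)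
Definition relabel (X Y B : finType) (D : nat) (f : Y -> X)
    (g : {ffun 'I_D -> Y + B}) : {ffun 'I_D -> X + B} :=
  [ffun k => mapl f (g k)].

Lemma leq_expl m n e : m <= n -> m ^ e <= n ^ e.
Proof. by case: e => // e; rewrite leq_exp2r. Qed.

(* Union bound over the position choices [g]: once the entries of the sample at
   the at most [D] positions used by [g] are fixed, all the other entries must
   avoid the set [K], which has relative size more than [1/M]. *)
Lemma exists_sample (X B : finType) (D r M : nat)
    (K : {ffun 'I_D -> X + B} -> {set X}) :
  0 < #|X| -> 0 < M ->
  (r + #|B|) ^ D * M.-1 ^ (r - D) < M ^ (r - D) ->
  exists f : {ffun 'I_r -> X}, forall g : {ffun 'I_D -> 'I_r + B},
    (forall i, f i \notin K (relabel f g)) -> M * #|K (relabel f g)| <= #|X|.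
Proof.
move=> X0 M0 hlt.
pose bad g := [set f : {ffun 'I_r -> X} |
  [forall i, f i \notin K (relabel f g)] && (#|X| < M * #|K (relabel f g)|)].
have [/existsP[f /forallP Hf]|Hbad] :=
    boolP [exists f, forall g : {ffun 'I_D -> 'I_r + B}, f \notin bad g].
  exists f => g Hg; rewrite leqNgt; apply: contra (Hf g) => HM.
  by rewrite inE HM andbT; apply/forallP.
(* In terms of probability: a fixed [g] is bad for at most a fraction [(1 - 1/M) ^ (r - D)] of the
   samples. *)
have bad_card g : #|bad g| * M ^ (r - D) <= #|X| ^ r * M.-1 ^ (r - D).
  have [x0 _] := card_gt0P X0.
  have [I IE] : exists I : {set 'I_r}, forall i,
      (i \in I) = [exists k, g k == inl i].
    by exists [set i : 'I_r | [exists k, g k == inl i]] => i; rewrite inE.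
  have cI : #|I| <= D.
    have -> : #|I| = #|[set @inl 'I_r B i | i in I]|.
      by rewrite card_imset //; move=> ? ? [].
    rewrite -[leqRHS]card_ord -cardsT; apply: leq_trans (leq_imset_card g _).
    apply: subset_leq_card; apply/subsetP => _ /imsetP[i + ->].
    by rewrite IE => /existsP[k /eqP <-]; rewrite imset_f.
  (* [rho] forgets the entries outside [I]. On each of its fibres [relabel f g] is constant, so the
     set to be avoided is fixed while the other [e] entries vary freely. *)
  pose rho (f : {ffun 'I_r -> X}) := [ffun i => if i \in I then f i else x0].
  have rhoE f : relabel (rho f) g = relabel f g.
    apply/ffunP => k; rewrite !ffunE; case E : (g k) => [i|//] /=.
    by rewrite ffunE IE ifT //; apply/existsP; exists k; rewrite E.
  pose F0 := family (fun i => [pred x | (i \in I) || (x == x0)]).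
  have cF0 : #|F0| = #|X| ^ #|I|.
    rewrite card_family foldrE big_map big_enum /= (bigID (mem I)) /=.
    rewrite [X in (_ * X)%N]big1 ?muln1.
      rewrite -prod_nat_const; apply: eq_bigr => i iI.
      by apply: eq_card => x; rewrite !inE iI.
    move=> i /negbTE iI; rewrite -(card1 x0).
    by apply: eq_card => x; rewrite !inE iI.
  pose e := #|~: I|.
  have Ie : #|I| + e = r by rewrite cardsC card_ord.
  have H1 : #|bad g| * M ^ e <= #|X| ^ #|I| * (M.-1 * #|X|) ^ e.
    rewrite -sum1_card (partition_big rho (mem F0)) /=; last first.
      move=> f _; apply/familyP => i; rewrite ffunE inE.
      by case: ifP => //= _.
    rewrite -cF0 -sum_nat_const big_distrl /=; apply: leq_sum => f0 _.
    rewrite sum1_card.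
    have [HM|HM] := ltnP #|X| (M * #|K (relabel f0 g)|); last first.
      rewrite eq_card0 ?mul0n // => f; apply/negP => /andP[].
      rewrite inE => /andP[_ h2] /eqP h3; move: h2.
      by rewrite -rhoE h3 ltnNge HM.
    pose F1 := family (fun i => [pred x | if i \in I then x == f0 i
                  else x \notin K (relabel f0 g)]).
    have cF1 : #|F1| = #|~: K (relabel f0 g)| ^ e.
      rewrite card_family foldrE big_map big_enum /= (bigID (mem I)) /=.
      rewrite [X in (X * _)%N]big1 ?mul1n.
        rewrite -prod_nat_const; apply: eq_big => [i|i iI].
          by rewrite inE.
        by apply: eq_card => x; rewrite !inE (negbTE iI).
      move=> i iI; rewrite -(card1 (f0 i)).
      by apply: eq_card => x; rewrite !inE iI.
    apply: (@leq_trans (#|F1| * M ^ e)).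
      rewrite leq_mul2r; apply/orP; right; apply: subset_leq_card.
      apply/subsetP => f /andP[].
      rewrite inE => /andP[/forallP h1 _] /eqP h3.
      apply/familyP => i; rewrite inE; case: ifP => iI.
        by rewrite -h3 ffunE iI.
      by rewrite -h3 rhoE; apply: h1.
    rewrite cF1 -expnMn; apply: leq_expl.
    have := cardsC (K (relabel f0 g)); move: HM.
    by case: (M) M0 => // M' _ /=; nia.
  (* [g] may use fewer than [D] positions, so [e] can exceed [r - D]; the [k] surplus factors are
     estimated by [M.-1 <= M]. *)
  have [k ke] : exists k, e = k + (r - D) by exists (e - (r - D)); lia.
  have Mk : 0 < M ^ k by rewrite expn_gt0 M0.
  rewrite -(leq_pmul2r Mk) -mulnA -expnD addnC -ke.
  apply: (leq_trans H1); rewrite expnMn mulnCA -expnD Ie mulnC -mulnA leq_mul2l.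
  apply/orP; right; rewrite ke expnD mulnC leq_mul2l.
  by rewrite leq_expl ?orbT // leq_pred.
have tot : #|X| ^ r <= \sum_(g : {ffun 'I_D -> 'I_r + B}) #|bad g|.
  rewrite -[X in _ ^ X]card_ord -card_ffun -sum1_card.
  have -> : \sum_g #|bad g| = \sum_g \sum_(f : {ffun 'I_r -> X}) (f \in bad g).
    by apply: eq_bigr => g _; rewrite -sum1_card big_mkcond.
  rewrite exchange_big; apply: leq_sum => f _.
  have /forallPn[g] : ~~ [forall g : {ffun 'I_D -> 'I_r + B}, f \notin bad g].
    by apply: contra Hbad => h; apply/existsP; exists f.
  by rewrite negbK => fg; rewrite (bigD1 g) //= fg.
have X0r : 0 < #|X| ^ r by rewrite expn_gt0 X0.
have : #|X| ^ r * M ^ (r - D) <=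
       (r + #|B|) ^ D * (#|X| ^ r * M.-1 ^ (r - D)).
  have -> : (r + #|B|) ^ D = #|{ffun 'I_D -> 'I_r + B}|.
    by rewrite card_ffun card_sum !card_ord.
  rewrite -sum_nat_const; apply: leq_trans (leq_mul tot (leqnn _)) _.
  by rewrite big_distrl /=; apply: leq_sum.
by rewrite mulnCA leq_pmul2l // leqNgt hlt.
Qed.

End Sampling.

(** * Vertices of polyhedra *)

(** Counting by an injection in relational form: codes only have to exist, and no coding function
    has to be chosen. *)
Lemma size_le_card_codes (T : eqType) (C : finType) (Q : T -> C -> Prop)
    (s : seq T) : uniq s ->
  (forall x, x \in s -> exists c, Q x c) ->
  (forall x y c, x \in s -> y \in s -> Q x c -> Q y c -> x = y) ->
  (size s <= #|C|)%N.
Proof.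
move=> us Hex Hinj.
have [t [<- ut _]] : exists t : seq C, [/\ size t = size s, uniq t &
    forall c, c \in t -> exists2 x, x \in s & Q x c].
  elim: s us Hex Hinj => [|x s IH] /=; first by exists [::].
  move=> /andP[xs us] Hex Hinj.
  have [||t [st ut Ht]] := IH us.
  - by move=> y ys; apply: Hex; rewrite inE ys orbT.
  - by move=> y z c ys zs; apply: Hinj; rewrite inE ?ys ?zs orbT.
  have [|c Qc] := Hex x; first by rewrite mem_head.
  exists (c :: t); split => /=; first by rewrite st.
    rewrite ut andbT; apply/negP => /Ht[y ys Qy].
    by rewrite (Hinj x y c) ?ys ?mem_head // ?inE ?ys ?orbT // in xs.
  move=> c'; rewrite inE => /orP[/eqP ->|/Ht[y ys Qy]].
    by exists x; rewrite ?mem_head.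
  by exists y; rewrite // inE ys orbT.
by rewrite -(card_uniqP ut) max_card.
Qed.

Section Polyhedra.
Variables (R : realFieldType) (D : nat).
Implicit Types (x y v : 'cV[R]_D) (c : 'rV[R]_D).

Definition dotp c x : R := (c *m x) 0 0.

Lemma dotpD c x y : dotp c (x + y) = dotp c x + dotp c y.
Proof. by rewrite /dotp mulmxDr mxE. Qed.

Lemma dotpZ c t y : dotp c (t *: y) = t * dotp c y.
Proof. by rewrite /dotp -scalemxAr mxE. Qed.

(** Perturb the functional for the tail by a multiple [t] of [w^T]. Each vector not orthogonal to
    [w] excludes one value of [t], and [t] is chosen larger than all of these; a vector orthogonal
    to [w] is not affected, and [w] itself is not of this kind. *)
Lemma exists_generic_functional (s : seq 'cV[R]_D) : 0 \notin s ->
  exists c, forall w, w \in s -> dotp c w != 0.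
Proof.
elim: s => [|w s IH]; first by exists 0.
rewrite inE negb_or eq_sym => /andP[w0 /IH[c Hc]].
pose bd := [seq - dotp c y / dotp w^T y | y <- w :: s].
pose t := 1 + \sum_(z <- bd) `|z|.
have tb z : z \in bd -> t != z.
  move=> zb; rewrite gt_eqF //; apply: (le_lt_trans (ler_norm z)).
  rewrite /t (perm_big _ (perm_to_rem zb)) big_cons /=.
  have : 0 <= \sum_(z <- rem z bd) `|z| by apply: sumr_ge0.
  lra.
have dD y : dotp (c + t *: w^T) y = dotp c y + t * dotp w^T y.
  by rewrite /dotp mulmxDl -scalemxAl !mxE.
exists (c + t *: w^T) => y; rewrite dD => ys.
have [E|E] := eqVneq (dotp w^T y) 0.
  rewrite E mulr0 addr0; move: ys; rewrite inE => /orP[/eqP yw|]; last exact: Hc.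
  case/eqP: w0; apply/matrixP => i j; rewrite (ord1 j) mxE.
  move: E; rewrite yw /dotp mxE => /eqP.
  rewrite psumr_eq0 => [|k _]; last by rewrite mxE -expr2 sqr_ge0.
  move=> /allP/(_ i); rewrite mem_index_enum => /(_ isT) /=.
  by rewrite mxE -expr2 sqrf_eq0 => /eqP.
have := tb _ (map_f (fun y => - dotp c y / dotp w^T y) ys).
apply: contraNN => /eqP H; apply/eqP/(mulIf E); rewrite mulfVK //; lra.
Qed.

Variables (J : finType) (a : J -> 'rV[R]_D) (b : J -> R).

Definition slack j x : R := dotp (a j) x - b j.
Definition feasible x := [forall j, 0 <= slack j x].
Definition basis_mx (h : {ffun 'I_D -> J}) : 'M[R]_D :=
  \matrix_(k < D) a (h k).
Definition basis_point (h : {ffun 'I_D -> J}) : 'cV[R]_D :=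
  invmx (basis_mx h) *m \col_(k < D) b (h k).

Lemma basis_mxE h x k : (basis_mx h *m x) k 0 = dotp (a (h k)) x.
Proof.
by rewrite /dotp -[a (h k)](rowK (fun k => a (h k))) -row_mul [RHS]mxE.
Qed.

Lemma basis_pointP h x : basis_mx h \in unitmx ->
  (forall k, slack (h k) x = 0) <-> x = basis_point h.
Proof.
move=> uh; split=> [H|->] /=.
  apply: (can_inj (mulKmx uh)); rewrite /basis_point mulKVmx //.
  apply/matrixP => k j; rewrite (ord1 j) basis_mxE mxE.
  by apply/eqP; rewrite -subr_eq0; apply/eqP/H.
move=> k; rewrite /slack.
have -> : dotp (a (h k)) (basis_point h) = b (h k); last exact: subrr.
by rewrite -basis_mxE /basis_point mulKVmx // mxE.
Qed.

(** These are the basic feasible solutions; [undup] is there because a degenerate vertex comes from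
    several bases. *)
Definition vertices : seq 'cV[R]_D :=
  undup [seq basis_point h | h <- enum {ffun 'I_D -> J} &
    (basis_mx h \in unitmx) && feasible (basis_point h)].

Lemma mem_vertices v : reflect
  (exists h, [/\ basis_mx h \in unitmx, feasible (basis_point h) &
     v = basis_point h])
  (v \in vertices).
Proof.
rewrite mem_undup; apply: (iffP mapP) => [[h]|[h [h1 h2 ->]]].
  by rewrite mem_filter => /andP[/andP[? ?] _] ->; exists h.
by exists h; rewrite // mem_filter h1 h2 mem_enum.
Qed.

(* Write a generic functional [c] in the basis of normals tight at a vertex.  On
   the face where the constraints whose coefficients have the minority sign are
   tight, the vertex is the unique minimum or maximum of [c].  Hence at most
   [D/2] constraints and a sign determine the vertex. *)
Lemma size_vertices : (size vertices <= 2 * (#|J|.+1) ^ D./2)%N.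
Proof.
(* These are the edge directions at all bases. If [c] vanishes on none of them, then all its
   coefficients [mu] in any basis of normals are nonzero. *)
pose ws := [seq col hk.2 (invmx (basis_mx hk.1)) |
  hk <- enum {: {ffun 'I_D -> J} * 'I_D} & basis_mx hk.1 \in unitmx].
have [|c Hc] := @exists_generic_functional ws.
  apply/negP => /mapP[[h k]]; rewrite mem_filter /= => /andP[uh _] H.
  have : row k (invmx (basis_mx h))^T *m (basis_mx h)^T = 0.
    by rewrite -tr_col -H trmx0 mul0mx.
  rewrite -row_mul -trmx_mul mulmxV // trmx1 => /rowP/(_ k).
  by rewrite !mxE eqxx => /eqP; rewrite oner_eq0.
(* [None] pads codes that use fewer than [D./2] constraints. *)
pose zero_on (e : {ffun 'I_(D./2) -> option J}) x :=
  forall i j, e i = Some j -> slack j x = 0.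
pose Q v (se : bool * {ffun 'I_(D./2) -> option J}) :=
  zero_on se.2 v /\ forall x, feasible x -> zero_on se.2 x ->
    0 <= (-1) ^+ se.1 * (dotp c x - dotp c v) /\ (dotp c x = dotp c v -> x = v).
have -> : (2 * (#|J|.+1) ^ D./2 = #|{: bool * {ffun 'I_(D./2) -> option J}}|)%N.
  by rewrite card_prod card_bool card_ffun card_option card_ord.
apply: (@size_le_card_codes _ _ Q); first exact: undup_uniq.
- move=> _ /mem_vertices[h [uh fh ->]]; set v := basis_point h.
  have [mu muE] : exists mu, mu = c *m invmx (basis_mx h) by eexists.
  have v0 k : slack (h k) v = 0 by move: k; apply/basis_pointP.
  have cE x : dotp c x - dotp c v = \sum_k mu 0 k * slack (h k) x.
    have cE1 z : dotp c z = \sum_k mu 0 k * dotp (a (h k)) z.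
      have -> : c = mu *m basis_mx h by rewrite muE mulmxKV.
      rewrite /dotp -mulmxA mxE.
      by apply: eq_bigr => k _; rewrite basis_mxE.
    rewrite !cE1 -sumrB; apply: eq_bigr => k _.
    by rewrite -mulrBr; congr (_ * _); move: (v0 k); rewrite /slack; lra.
  have mu0 k : mu 0 k != 0.
    have -> : mu 0 k = dotp c (col k (invmx (basis_mx h))).
      by rewrite muE /dotp !mxE; apply: eq_bigr => i _; rewrite mxE.
    apply: Hc.
    by apply/mapP; exists (h, k); rewrite // mem_filter /= uh mem_enum.
  (* No coefficient is zero, so [mu] and [- mu] have [D] negative entries together, and one of them
     has at most [D./2]. *)
  have [s Zs] : exists s : bool,
      (#|[set k | ((-1) ^+ s * mu 0 k < 0)%R]| <= D./2)%N.
    have : (#|[set k | (mu 0 k < 0)%R]| + #|[set k | (- mu 0 k < 0)%R]| = D)%N.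
      rewrite -[RHS]card_ord -[RHS](cardsC [set k | (mu 0 k < 0)%R]).
      congr (_ + #|pred_of_set _|)%N; apply/setP => k; rewrite !inE oppr_lt0.
      by rewrite -leNgt lt_neqAle eq_sym mu0.
    have [H|H] := leqP #|[set k | (mu 0 k < 0)%R]| D./2.
      exists false; move: H; congr (#|pred_of_set _| <= _)%N.
      by apply/setP => k; rewrite !inE expr0 mul1r.
    move=> H2; exists true.
    have -> : [set k | (-1) ^+ true * mu 0 k < 0] = [set k | - mu 0 k < 0].
      by apply/setP => k; rewrite !inE expr1 mulN1r.
    by lia.
  set Z := [set k | _] in Zs.
  pose e := [ffun i : 'I_(D./2) => nth None [seq Some (h k) | k <- enum Z] i].
  have eZ k : k \in Z -> exists i, e i = Some (h k).
    move=> kZ; have ik : (index k (enum Z) < D./2)%N.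
      by apply: leq_trans Zs; rewrite cardE index_mem mem_enum.
    exists (Ordinal ik); rewrite ffunE (nth_map k) /= ?nth_index ?mem_enum //.
    by rewrite index_mem mem_enum.
  exists (s, e); split => /=.
    move=> i j; rewrite ffunE.
    have [H|H] := ltnP i (size (enum Z)); last first.
      by rewrite nth_default // size_map.
    have k0 : 'I_D by move: H; case: (enum Z).
    by rewrite (nth_map k0) // => -[<-].
  move=> x /forallP fx zx; rewrite cE.
  have ge0 k : 0 <= (-1) ^+ s * mu 0 k * slack (h k) x.
    have [/eZ[i ei]|kZ] := boolP (k \in Z).
      by rewrite (zx _ _ ei) mulr0.
    by apply: mulr_ge0 => //; move: kZ; rewrite inE -leNgt.
  have sE : (-1) ^+ s * (\sum_k mu 0 k * slack (h k) x) =
            \sum_k (-1) ^+ s * mu 0 k * slack (h k) x.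
    by rewrite mulr_sumr; apply: eq_bigr => k _; rewrite mulrA.
  split; first by rewrite sE; apply: sumr_ge0.
  move/eqP; rewrite -subr_eq0 cE => /eqP H.
  move: sE; rewrite H mulr0 => /esym/eqP; rewrite psumr_eq0 // => /allP H2.
  apply/basis_pointP => // k; have := H2 k; rewrite mem_index_enum => /(_ isT).
  by rewrite !mulf_eq0 signr_eq0 (negbTE (mu0 k)) /= => /eqP.
move=> x y [s e] /mem_vertices[h [_ fx ->]] /mem_vertices[h' [_ fy ->]].
move=> [/= zx Hx] [/= zy Hy].
(* Two vertices with the same code lie on the same face and are both extremal there for the same
   sign, so [c] takes equal values at them. *)
have [hx _] := Hx _ fy zy; have [hy Ey] := Hy _ fx zx.
apply: Ey; move: hx hy; case: (s); rewrite ?expr1 ?expr0; lra.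
Qed.

(* What affine functionals see of [x] being a convex combination of [W] with
   positive coefficients. *)
Definition in_hull (W : seq 'cV[R]_D) x := forall (al : 'rV[R]_D) (be : R),
  (forall w, w \in W -> 0 <= dotp al w - be) ->
  0 <= dotp al x - be /\
  (dotp al x - be = 0 -> forall w, w \in W -> dotp al w - be = 0).

Lemma in_hull1 x : in_hull [:: x] x.
Proof.
move=> al be H; split; first by apply: H; rewrite mem_head.
by move=> E w; rewrite inE => /eqP ->.
Qed.

(** [x] is the combination of the two shifted points with weights proportional to [t2] and [t1].
    Both are positive, so a functional that is nonnegative at these points and vanishes at [x]
    vanishes at both. *)
Lemma in_hull_cat W1 W2 x y (t1 t2 : R) : 0 < t1 -> 0 < t2 ->
  in_hull W1 (x + t1 *: y) -> in_hull W2 (x - t2 *: y) ->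
  in_hull (W1 ++ W2) x.
Proof.
move=> t10 t20 H1 H2 al be H.
have [|h1 e1] := H1 al be; first by move=> w ww; apply: H; rewrite mem_cat ww.
have [|h2 e2] := H2 al be.
  by move=> w ww; apply: H; rewrite mem_cat ww orbT.
move: h1 e1 h2 e2; rewrite -scaleNr !dotpD !dotpZ.
set p := dotp al x; set q := dotp al y => h1 e1 h2 e2.
have h3 : 0 <= (t1 + t2) * (p - be).
  have := mulr_ge0 (ltW t20) h1; have := mulr_ge0 (ltW t10) h2; lra.
split; first by move: h3; rewrite pmulr_rge0 //; lra.
move=> E w; rewrite mem_cat.
have q0 : q = 0.
  have q1 : 0 <= q by rewrite -(pmulr_rge0 _ t10); lra.
  have q2 : 0 <= - q by rewrite -(pmulr_rge0 _ t20); lra.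
  lra.
by move=> /orP[]; [apply: e1|apply: e2]; rewrite q0; lra.
Qed.

(** Zero rows stand in for the constraints that are not tight. The format is thus the same for all
    points, and row spaces at different points can be compared. *)
Definition tight_mx x : 'M[R]_(#|J|, D) :=
  \matrix_(i < #|J|)
    (if slack (enum_val i) x == 0 then a (enum_val i) else 0).

Lemma tight_mx_row x j : slack j x = 0 -> row (enum_rank j) (tight_mx x) = a j.
Proof. by move=> E; rewrite rowK enum_rankK E eqxx. Qed.

(** Full rank provides [D] independent rows. None of them is a zero row, so they belong to tight
    constraints and form a basis at [x]. *)
Lemma row_full_vertex x : feasible x -> row_full (tight_mx x) ->
  x \in vertices.
Proof.
move=> fx full; have uA := fullrowsub_unit full.
set f := fullrankfun full in uA.
pose h := [ffun k => enum_val (f k)].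
have hrow k : slack (h k) x = 0.
  apply/eqP; apply: contraT => nz.
  have : row k (rowsub f (tight_mx x)) = 0.
    by rewrite row_rowsub rowK -[enum_val _](ffunE (fun k => enum_val (f k)))
       (negbTE nz).
  rewrite rowE => /(canRL (mulmxK uA)); rewrite mul0mx => /rowP/(_ k).
  by rewrite !mxE !eqxx => /eqP; rewrite oner_eq0.
have hE : basis_mx h = rowsub f (tight_mx x).
  apply/row_matrixP => k; rewrite row_rowsub !rowK.
  by have := hrow k; rewrite !ffunE => ->; rewrite eqxx.
have uh : basis_mx h \in unitmx by rewrite hE.
have xE : x = basis_point h by apply/basis_pointP.
by apply/mem_vertices; exists h; rewrite -xE.
Qed.

(** This says that the recession cone is trivial: no ray stays in the polyhedron. *)
Hypothesis bounded : forall y, y != 0 -> exists j, dotp (a j) y < 0.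

(** Walk along [y] until the first constraint blocks, found by the usual ratio test. The constraints
    tight at [x] stay tight because [y] is in their kernel; the blocking one does not annihilate
    [y], so it is independent of them. *)
Lemma rank_increasing_move x y : feasible x -> y != 0 ->
  tight_mx x *m y = 0 ->
  exists2 t, 0 < t & feasible (x + t *: y) /\
    (\rank (tight_mx x) < \rank (tight_mx (x + t *: y)))%N.
Proof.
move=> /forallP fx /bounded[j0 j0P] xy.
have slackE j t : slack j (x + t *: y) = slack j x + t * dotp (a j) y.
  by rewrite /slack dotpD dotpZ; lra.
have tight0 x' j : tight_mx x' *m y = 0 -> slack j x' = 0 -> dotp (a j) y = 0.
  by move=> x'y /tight_mx_row <-; rewrite /dotp -row_mul x'y !mxE.
pose t j := slack j x / - dotp (a j) y.
case: (arg_minP (P := [pred j | dotp (a j) y < 0]) t j0P) => j /= jy jmin.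
have sj : 0 < slack j x.
  rewrite lt_neqAle fx andbT eq_sym; apply/eqP => /(tight0 _ _ xy) E.
  by rewrite E ltxx in jy.
have t0 : 0 < t j by rewrite divr_gt0 // oppr_gt0.
have fx' : feasible (x + t j *: y).
  apply/forallP => i; rewrite slackE.
  have [iy|iy] := ltP (dotp (a i) y) 0.
    have := jmin _ iy; rewrite [X in _ <= X]/t ler_pdivlMr ?oppr_gt0 //; lra.
  by rewrite addr_ge0 // mulr_ge0 // ltW.
exists (t j) => //; split => //; set x' := x + _ in fx' *.
have tj : slack j x' = 0.
  rewrite slackE /t invrN mulrN mulNr divfK ?subrr //.
  by rewrite lt_eqF.
apply: rank_ltmx; rewrite ltmxE; apply/andP; split.
  apply/row_subP => i; rewrite rowK; case: eqP => [E|_]; last exact: sub0mx.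
  have <- : row i (tight_mx x') = a (enum_val i); last exact: row_sub.
  rewrite rowK slackE E (tight0 x (enum_val i)) // mulr0 addr0 eqxx //.
apply/negP => /submxP[B BE].
have /tight0/(_ tj) E : tight_mx x' *m y = 0 by rewrite BE -mulmxA xy mulmx0.
by rewrite E ltxx in jy.
Qed.

(** Induction on the corank of the tight constraints: moving from [x] both ways along a kernel
    direction gives two points of smaller corank with [x] between them. Each of at most [D] rounds
    doubles the number of vertices. *)
Lemma feasible_in_hull x : feasible x ->
  exists W, [/\ (size W <= 2 ^ D)%N, {subset W <= vertices} & in_hull W x].
Proof.
suff H : forall n x, (D - \rank (tight_mx x) <= n)%N -> feasible x ->
    exists W, [/\ (size W <= 2 ^ n)%N, {subset W <= vertices} & in_hull W x].
  by apply: H; apply: leq_subr.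
elim=> [|n IH] {}x.
  move=> rx fx; exists [:: x]; split => //; last exact: in_hull1.
  move=> w; rewrite inE => /eqP ->; apply: row_full_vertex => //.
  by rewrite /row_full eqn_leq rank_leq_col; lia.
move=> rx fx; have [full|nfull] := boolP (row_full (tight_mx x)).
  exists [:: x]; split; [by rewrite expn_gt0| |exact: in_hull1].
  by move=> w; rewrite inE => /eqP ->; apply: row_full_vertex.
have rD : (\rank (tight_mx x) < D)%N.
  by rewrite ltn_neqAle rank_leq_col andbT.
have [j yj] : exists j, col j (cokermx (tight_mx x)) != 0.
  apply/existsP; apply: contraT; rewrite negb_exists => /forallP H.
  have : \rank (cokermx (tight_mx x)) = 0%N.
    apply/eqP; rewrite mxrank_eq0; apply/eqP/matrixP => i k.
    have := H k; rewrite negbK => /eqP/colP/(_ i).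
    by rewrite !mxE.
  by rewrite mxrank_coker; lia.
set y := col _ _ in yj.
have xy : tight_mx x *m y = 0.
  by rewrite /y colE mulmxA mulmx_coker mul0mx.
have [t1 t10 [f1 r1]] := rank_increasing_move fx yj xy.
have [||t2 t20 [f2 r2]] := @rank_increasing_move x (- y) fx.
- by rewrite oppr_eq0.
- by rewrite mulmxN xy oppr0.
have [||W1 [s1 v1 h1]] := IH (x + t1 *: y); [lia|done|].
have [||W2 [s2 v2 h2]] := IH (x + t2 *: - y);
  [by apply: leq_trans (leq_sub2l D r2) _; lia|done|].
exists (W1 ++ W2); split.
- by rewrite size_cat expnS mul2n -addnn leq_add.
- by move=> w; rewrite mem_cat => /orP[/v1|/v2].
by rewrite scalerN in h2; apply: in_hull_cat h1 h2.
Qed.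

End Polyhedra.

(** * Cuttings and the recursive step *)

(** A vertex of the sampled polytope is feasible, so no sampled function is negative there. This is
    the avoidance condition of [exists_sample] for the set of functions negative at that vertex. *)
Lemma shallow_cutting (R : realFieldType) (D r M : nat) (I J : finType)
    (a : I -> 'rV[R]_D) (b : I -> R) (y : J -> 'cV[R]_D) :
  (0 < #|I|)%N -> (0 < M)%N ->
  ((r + D * 2) ^ D * M.-1 ^ (r - D) < M ^ (r - D))%N ->
  (forall i j, 0 <= slack a b i (y j)) ->
  exists V : seq 'cV[R]_D,
    [/\ uniq V, (size V <= 2 * (r + D * 2).+1 ^ D./2)%N,
        forall v, v \in V -> (M * #|[set i | (slack a b i v < 0)%R]| <= #|I|)%N &
        forall j, exists W, [/\ (size W <= 2 ^ D)%N, {subset W <= V} &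
          in_hull W (y j)]].
Proof.
move=> I0 M0 hrM ya.
pose B : finType := ('I_D * bool)%type.
(* Half-width of a box centred at the origin that contains all points [y j]. *)
pose size_y := \sum_j \sum_k `|y j k 0|.
pose a' (u : I + B) : 'rV[R]_D := match u with
  | inl i => a i | inr (k, s) => (-1) ^+ s *: delta_mx 0 k end.
pose b' (u : I + B) : R := match u with inl i => b i | inr _ => - size_y end.
pose K (h : {ffun 'I_D -> I + B}) :=
  [set i | slack a b i (basis_point a' b' h) < 0].
have cB : #|B| = (D * 2)%N by rewrite card_prod card_ord card_bool.
have [f Hf] : exists f : {ffun 'I_r -> I}, forall g : {ffun 'I_D -> 'I_r + B},
    (forall i, f i \notin K (relabel f g)) -> (M * #|K (relabel f g)| <= #|I|)%N.
  by apply: exists_sample => //; rewrite cB.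
pose af u := a' (mapl f u); pose bf u := b' (mapl f u).
have box k s x : dotp ((-1) ^+ s *: delta_mx 0 k : 'rV[R]_D) x =
    (-1) ^+ s * x k 0.
  rewrite /dotp -scalemxAl -rowE !mxE //.
exists (vertices af bf); split; first exact: undup_uniq.
- by apply: leq_trans (size_vertices _ _) _; rewrite card_sum card_ord cB.
- move=> v /mem_vertices[h [uh /forallP fh ->]].
  have E : basis_point af bf h = basis_point a' b' (relabel f h).
    rewrite /basis_point; congr (invmx _ *m _).
      by apply/row_matrixP => k; rewrite !rowK ffunE.
    by apply/colP => k; rewrite !mxE ffunE.
  rewrite E in fh *; apply: Hf => i; rewrite inE -leNgt.
  exact: fh (inl i).
move=> j; apply: feasible_in_hull => [x x0|].
  have [k xk] : exists k, x k 0 != 0.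
    apply/existsP; apply: contraT; rewrite negb_exists => /forallP H.
    case/eqP: x0; apply/colP => k; rewrite mxE.
    by have := H k; rewrite negbK => /eqP.
  exists (inr (k, 0 < x k 0)); rewrite /af /= box.
  move: xk; rewrite real_neqr_lt ?num_real //; case: ltgtP => // H _.
    by rewrite expr0 mul1r.
  by rewrite expr1 mulN1r oppr_lt0.
apply/forallP => -[i|[k s]]; first exact: ya.
rewrite /slack /af /bf /= box opprK.
have H : `|y j k 0| <= size_y.
  rewrite /size_y (bigD1 j) //= (bigD1 k) //= -addrA lerDl.
  by rewrite addr_ge0 // ?sumr_ge0 // => ? _; rewrite ?sumr_ge0.
have := ler_norm (y j k 0); have := ler_norm (- y j k 0); rewrite normrN.
case: s; rewrite ?expr0 ?expr1; lra.
Qed.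

Definition edges (I J : finType) (e : I -> J -> bool) (A : {set I})
    (B : {set J}) : {set I * J} :=
  [set p | [&& p.1 \in A, p.2 \in B & e p.1 p.2]].

Definition biclique_free (I J : finType) (e : I -> J -> bool) (u : nat) :=
  forall (A : {set I}) (B : {set J}),
    (forall i j, i \in A -> j \in B -> e i j) -> (#|A| < u)%N \/ (#|B| < u)%N.

Lemma card_bigcup_le (K T : finType) (F : K -> {set T}) :
  (#|\bigcup_k F k| <= \sum_k #|F k|)%N.
Proof.
elim/big_rec2: _ => [|k n X _ IH]; first by rewrite cards0.
by apply: leq_trans (leq_card_setU _ _) _; rewrite leq_add2l.
Qed.

(** The factor [2 ^ D] counts the vertices whose hull contains a given point, hence the subproblems
    it enters. The factor [2 ^ N] counts the possible vertex sets, one biclique for each. *)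
Lemma incidence_step (R : realFieldType) (D r M u : nat) (I J : finType)
    (a : I -> 'rV[R]_D) (b : I -> R) (y : J -> 'cV[R]_D)
    (e : I -> J -> bool) (A : {set I}) (B : {set J}) :
  let N := (2 * (r + D * 2).+1 ^ D./2)%N in
  (0 < M)%N -> ((r + D * 2) ^ D * M.-1 ^ (r - D) < M ^ (r - D))%N ->
  (forall i j, 0 <= slack a b i (y j)) ->
  (forall i j, e i j = (slack a b i (y j) == 0)) ->
  biclique_free e u -> (0 < #|A|)%N ->
  exists n (A' : 'I_n -> {set I}) (B' : 'I_n -> {set J}), (n <= N)%N /\
    [/\ forall k, (M * #|A' k| <= #|A|)%N,
        forall k, B' k \subset B,
        (\sum_k #|B' k| <= 2 ^ D * #|B|)%N &
        (#|edges e A B| <= \sum_k #|edges e (A' k) (B' k)| +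
                           2 ^ N * u * (#|A| + #|B|))%N].
Proof.
move=> N M0 hrM ya eE efree A0.
(* Cutting over the subtype of [A] makes the shrinking factor [M] relative to [A] instead of [I]. *)
have A0' : (0 < #|{: {i | i \in A}}|)%N by rewrite card_sig.
have [V [uV sV cV hV]] := @shallow_cutting R D r M {i | i \in A} J
  (fun i => a (val i)) (fun i => b (val i)) y A0' M0 hrM
  (fun i j => ya (val i) j).
have [W HW] := fin_all_exists hV.
pose Vk (k : 'I_(size V)) := nth 0 V k.
have VkV k : Vk k \in V by apply: mem_nth.
pose mark j := [set k | Vk k \in W j].
pose A' k := [set i in A | slack a b i (Vk k) < 0].
pose B' k := [set j in B | k \in mark j].
exists (size V), A', B'; split => //; split.
- move=> k; have := cV _ (VkV k); rewrite card_sig.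
  have -> : A' k = val @: [set i : {i | i \in A} | slack a b (val i) (Vk k) < 0].
    apply/setP => i; rewrite inE; apply/andP/imsetP => [[iA H]|[i' H ->]].
      by exists (Sub i iA); rewrite ?inE.
    by move: H; rewrite inE => ->; split=> //; apply: valP.
  by rewrite (card_imset _ val_inj).
- by move=> k; apply/subsetP => j; rewrite inE => /andP[].
- have mark_size j : (#|mark j| <= 2 ^ D)%N.
    have [sW _ _] := HW j; apply: leq_trans sW.
    rewrite cardE -(size_map Vk); apply: uniq_leq_size.
      rewrite map_inj_uniq ?enum_uniq // => k k' /eqP.
      by rewrite nth_uniq // => /eqP/val_inj.
    by move=> v /mapP[k]; rewrite mem_enum inE => ? ->.
  under eq_bigr => k _ do rewrite -sum1_card big_mkcond /=.
  rewrite exchange_big /= mulnC -sum_nat_const [X in (_ <= X)%N]big_mkcond /=.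
  apply: leq_sum => j _; case: ifP => jB; last first.
    by rewrite big1 // => k _; rewrite !inE jB.
  apply: leq_trans (mark_size j); rewrite -sum1_card [X in (_ <= X)%N]big_mkcond.
  by apply: leq_sum => k _; rewrite inE jB.
pose H (w : {set 'I_(size V)}) :=
  [set i in A | [forall k in w, slack a b i (Vk k) == 0]].
pose G w := [set j in B | mark j == w].
have sub : edges e A B \subset
    (\bigcup_k edges e (A' k) (B' k)) :|: (\bigcup_w setX (H w) (G w)).
  apply/subsetP => -[i j]; rewrite inE /= => /and3P[iA jB eij].
  rewrite inE; apply/orP.
  have [_ WV hull] := HW j.
  have [/existsP[k /andP[kj ki]]|nk] :=
      boolP [exists k, (k \in mark j) && (slack a b i (Vk k) < 0)].
    left; apply/bigcupP; exists k => //; rewrite inE /= eij andbT.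
    by apply/andP; split; rewrite inE ?iA ?jB.
  right; apply/bigcupP; exists (mark j) => //; rewrite inE /=.
  apply/andP; split; rewrite inE ?jB ?iA /=; last exact: eqxx.
  apply/forall_inP => k; rewrite inE => kj.
  have [|_ H0] := hull (a i) (b i).
    move=> w ww; have wV := WV _ ww.
    have kw : (index w V < size V)%N by rewrite index_mem.
    rewrite leNgt; apply: contra nk => h; apply/existsP; exists (Ordinal kw).
    by rewrite inE /Vk /= nth_index // ww.
  by apply/eqP/H0 => //; apply/eqP; move: eij; rewrite eE.
apply: leq_trans (subset_leq_card sub) _.
apply: leq_trans (leq_card_setU _ _) _; apply: leq_add.
  exact: card_bigcup_le.
apply: leq_trans (card_bigcup_le _) _.
have HG w : (#|setX (H w) (G w)| <= u * (#|A| + #|B|))%N.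
  rewrite cardsX.
  have HA : (#|H w| <= #|A|)%N.
    by apply: subset_leq_card; apply/subsetP => i; rewrite inE => /andP[].
  have GB : (#|G w| <= #|B|)%N.
    by apply: subset_leq_card; apply/subsetP => i; rewrite inE => /andP[].
  have [|Hu|Gu] := efree (H w) (G w); [|nia|nia].
  move=> i j; rewrite !inE => /andP[iA /forall_inP Hi] /andP[jB /eqP jw].
  have [_ WV hull] := HW j.
  have zero v : v \in W j -> slack a b i v = 0.
    move=> vW; have vV := WV _ vW.
    have kw : (index v V < size V)%N by rewrite index_mem.
    have := Hi (Ordinal kw); rewrite -jw inE /Vk /= nth_index // => /(_ vW).
    by move/eqP.
  rewrite eE eq_le ya andbT.
  (* The function vanishes on the whole vertex set, so the hull property also applies to its
     negative and gives value at most 0 at [y j]. *)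
  have [|h _] := hull (- a i) (- b i).
    move=> v /zero; rewrite /slack /dotp mulNmx !mxE; lra.
  by move: h; rewrite /slack /dotp mulNmx !mxE; lra.
apply: (@leq_trans (\sum_(w : {set 'I_(size V)}) u * (#|A| + #|B|))).
  by apply: leq_sum.
rewrite sum_nat_const -mulnA leq_mul2r; apply/orP; right.
have -> : #|{set 'I_(size V)}| = (2 ^ size V)%N.
  by rewrite -cardsT -powersetT card_powerset cardsT card_ord.
by rewrite leq_exp2l.
Qed.

(** * Solving the recursion *)

Section Numerics.
Variable R : realType.
Implicit Types (x t u m n : R).

Lemma powR_le (p : R) x t : 0 <= p -> 0 <= x -> x <= t -> x `^ p <= t `^ p.
Proof.
move=> p0 x0 xt; apply: ge0_ler_powR => //.
by rewrite nnegrE // (le_trans x0).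
Qed.

Lemma powRD_gt0 x (p q : R) : 0 < x -> x `^ (p + q) = x `^ p * x `^ q.
Proof. by move=> x0; apply: powRD; rewrite (gt_eqF x0) implybT. Qed.

(** The first summand suffices for [x <= t], the second for [x > t]. Being affine in [x], the bound
    can be summed. *)
Lemma powR_le_tangent (al : R) x t : 0 < al -> al <= 1 -> 0 <= x -> 0 < t ->
  x `^ al <= t `^ al + x * t `^ (al - 1).
Proof.
move=> al0 al1 x0 t0; have [xt|tx] := leP x t.
  apply: le_trans (powR_le (ltW al0) x0 xt) _.
  by rewrite lerDl mulr_ge0 ?powR_ge0.
have x0' := lt_trans t0 tx.
rewrite -(mulr_powRB1 x0 al0); apply: (@le_trans _ _ (x * t `^ (al - 1))).
  rewrite ler_pM2l // -(opprB 1 al) !powRN lef_pV2 ?posrE ?powR_gt0 //.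
  by apply: powR_le; rewrite ?subr_ge0 // ltW.
by rewrite lerDr powR_ge0.
Qed.

(** A substitute for Hölder's inequality, up to the constant: the preceding bound is summed with
    [t = m / N], which balances its two terms. *)
Lemma sum_powR_le (k : nat) (N c al m : R) (x : 'I_k -> R) :
  0 < al -> al <= 1 -> 0 < N -> k%:R <= N -> 0 < m ->
  (forall i, 0 <= x i) -> \sum_i x i <= c * m ->
  \sum_i x i `^ al <= (1 + c) * N `^ (1 - al) * m `^ al.
Proof.
move=> al0 al1 N0 kN m0 x0 sx; set t := m / N.
have t0 : 0 < t by rewrite divr_gt0.
apply: (@le_trans _ _ (\sum_i (t `^ al + x i * t `^ (al - 1)))).
  by apply: ler_sum => i _; apply: powR_le_tangent.
rewrite big_split /= -mulr_suml sumr_const card_ord -[_ *+ k]mulr_natl.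
have E : N * t `^ al = m * t `^ (al - 1).
  rewrite -(mulr_powRB1 (ltW t0) al0) mulrA; congr (_ * _).
  by rewrite /t mulrC divfK // gt_eqF.
have E2 : m * t `^ (al - 1) = N `^ (1 - al) * m `^ al.
  rewrite /t powRM ?invr_ge0 ?ltW // mulrA mulr_powRB1 ?(ltW m0) // mulrC.
  by rewrite -powR_inv1 ?(ltW N0) // -powRrM mulN1r opprB.
rewrite -mulrA -E2 mulrDl mul1r lerD //.
  by rewrite -E ler_wpM2r ?powR_ge0.
by rewrite mulrA ler_wpM2r ?powR_ge0.
Qed.

(** A form of the final bound symmetric in [m] and [n], used with [ga = s / (s + 1)]. With [ep / 2]
    in the second term, the surplus power in the main term is the square of the one there, which
    leaves room to absorb losses. *)
Definition edge_bound (ga ep u m n : R) : R :=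
  u `^ (2 * (1 - ga)) * (m * n) `^ (ga + ep) + u * (m + n) * (m * n) `^ (ep / 2).

Lemma edge_bound_ge0 ga ep u m n : 0 <= u -> 0 <= m -> 0 <= n ->
  0 <= edge_bound ga ep u m n.
Proof.
move=> u0 m0 n0; rewrite /edge_bound addr_ge0 // mulr_ge0 ?powR_ge0 //.
by rewrite mulr_ge0 // addr_ge0.
Qed.

Lemma edge_boundC ga ep u m n : edge_bound ga ep u m n = edge_bound ga ep u n m.
Proof. by rewrite /edge_bound (mulrC n) (addrC n). Qed.

(** Split off the power of [u] on the right. What remains of [u] has exponent [2 * ga - 1 >= 0], so
    it may be replaced by [n], and then [n * n <= m * n]. *)
Lemma linear_le_main_term (ga u m n : R) :
  2^-1 <= ga -> 0 < u -> u <= n -> n <= m ->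
  u * n <= u `^ (2 * (1 - ga)) * (m * n) `^ ga.
Proof.
move=> ga2 u0 un nm; have n0 := lt_le_trans u0 un.
have -> : u * n = u `^ (2 * (1 - ga)) * (u `^ (2 * ga - 1) * n).
  rewrite mulrA -powRD_gt0 //.
  by rewrite (_ : 2 * (1 - ga) + (2 * ga - 1) = 1); [rewrite powRr1 // ltW|ring].
rewrite ler_wpM2l ?powR_ge0 //.
apply: (@le_trans _ _ (n `^ (2 * ga - 1) * n)).
  by rewrite ler_wpM2r ?(ltW n0) // powR_le ?(ltW u0) //; lra.
have -> : n `^ (2 * ga - 1) * n = (n * n) `^ ga.
  rewrite -[X in _ * X]powRr1 ?(ltW n0) // -powRD_gt0 //.
  by rewrite powRM ?(ltW n0) // -powRD_gt0 //; congr powR; ring.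
by apply: powR_le;
  [lra|exact: mulr_ge0 (ltW n0) (ltW n0)|rewrite ler_wpM2r // ltW].
Qed.

(* [m] counts the points and [n] the functions.  For [n <= m] the contribution
   [u * n] of the subproblems is absorbed by the main term. *)
Lemma edge_bound_step (ga ep c N M u m n : R) (k : nat) (x y : 'I_k -> R) :
  2^-1 <= ga -> 0 < ep -> ga + ep <= 1 -> 0 < N -> 1 <= M -> 0 <= c ->
  (1 + c) * M^-1 `^ (ga + ep) * N `^ (1 - (ga + ep)) <= 4^-1 ->
  c * M^-1 `^ (ep / 2) <= 4^-1 ->
  0 < u -> u <= n -> n <= m -> 1 <= m * n -> 4 * N <= (m * n) `^ (ep / 2) ->
  k%:R <= N ->
  (forall i, 0 <= x i <= m) -> \sum_i x i <= c * m ->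
  (forall i, 0 <= y i <= n / M) ->
  \sum_i edge_bound ga ep u (x i) (y i) + 4^-1 * (u * (m + n)) <=
  edge_bound ga ep u m n.
Proof.
move=> ga2 ep0 al1 N0 M1 c0 hc1 hc2 u0 un nm mn1 hN kN hx sx hy.
have n0 := lt_le_trans u0 un; have m0 := lt_le_trans n0 nm.
have M0 : 0 < M by lra.
set al := ga + ep in al1 hc1 *; set be := ep / 2 in hc2 hN *.
have al0 : 0 < al by rewrite /al; lra.
have be0 : 0 < be by rewrite /be; lra.
have mn0 : 0 <= m * n by rewrite mulr_ge0 // ltW.
set U := u `^ (2 * (1 - ga)); have U0 : 0 <= U by rewrite powR_ge0.
set P := (m * n) `^ al; have P0 : 0 <= P by rewrite powR_ge0.
set Q := (m * n) `^ be; have Q0 : 0 <= Q by rewrite powR_ge0.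
have Q1 : 1 <= Q by rewrite -(powRr0 (m * n)) ler_powR // ltW.
have T1 : \sum_i U * (x i * y i) `^ al <= 4^-1 * (U * P).
  apply: (@le_trans _ _ (\sum_i U * (n / M) `^ al * x i `^ al)).
    apply: ler_sum => i _; have /andP[xi _] := hx i; have /andP[yi yi'] := hy i.
    rewrite -mulrA ler_wpM2l // powRM // mulrC ler_wpM2r ?powR_ge0 //.
    by apply: powR_le => //; apply: ltW.
  rewrite -mulr_sumr.
  have := sum_powR_le al0 al1 N0 kN m0 (fun i => proj1 (andP (hx i))) sx.
  move=> /(ler_wpM2l (mulr_ge0 U0 (powR_ge0 (n / M) al))) /le_trans; apply.
  rewrite powRM ?invr_ge0 ?(ltW n0) ?(ltW M0) // /P powRM ?(ltW n0) ?(ltW m0) //.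
  have H : 0 <= U * (m `^ al * n `^ al) by rewrite !mulr_ge0 ?powR_ge0.
  by have := ler_wpM2r H hc1; congr (_ <= _); ring.
have T2 : \sum_i u * (x i + y i) * (x i * y i) `^ be <=
    4^-1 * (u * (m + n) * Q) + 4^-1 * (U * P).
  set q := M^-1 `^ be in hc2; have q0 : 0 <= q by rewrite powR_ge0.
  have q1 : q <= 1.
    rewrite (_ : 1 = 1 `^ be); last by rewrite powR1.
    apply: powR_le; rewrite ?invr_ge0 ?(ltW be0) ?(ltW M0) //.
    by rewrite invf_le1.
  apply: (@le_trans _ _ (\sum_i (u * Q * q) * (x i + y i))).
    apply: ler_sum => i _; have /andP[xi xi'] := hx i; have /andP[yi yi'] := hy i.
    have -> : u * Q * q * (x i + y i) = u * (x i + y i) * (Q * q) by ring.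
    rewrite ler_wpM2l ?mulr_ge0 ?(ltW u0) ?addr_ge0 //.
    rewrite /Q /q -powRM ?invr_ge0 ?(ltW M0) //.
    apply: powR_le; [exact: ltW|exact: mulr_ge0|].
    by rewrite -[leRHS]mulrA ler_pM.
  rewrite -mulr_sumr big_split /=.
  have sy : \sum_i y i <= N * n.
    apply: (@le_trans _ _ (\sum_(i < k) n)).
      apply: ler_sum => i _; have /andP[_ yi'] := hy i.
      apply: (le_trans yi'); rewrite ler_pdivrMr // ler_peMr // ltW //.
    by rewrite sumr_const card_ord -[_ *+ k]mulr_natl ler_wpM2r // ltW.
  have uQ0 : 0 <= u * Q by rewrite mulr_ge0 // ltW.
  rewrite mulrDr lerD //.
    apply: (@le_trans _ _ (u * Q * q * (c * m))).
      by rewrite ler_wpM2l // mulr_ge0.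
    have H : 0 <= u * Q * m by rewrite mulr_ge0 // ltW.
    have := ler_wpM2r H hc2.
    have : 0 <= u * Q * n by rewrite mulr_ge0 // ltW.
    lra.
  apply: (@le_trans _ _ (u * Q * (N * n))).
    apply: (@le_trans _ _ (u * Q * q * (N * n))).
      by rewrite ler_wpM2l // mulr_ge0.
    rewrite ler_wpM2r ?mulr_ge0 ?(ltW N0) ?(ltW n0) //.
    by rewrite ler_piMr.
  have lin := linear_le_main_term ga2 u0 un nm.
  (* One factor [Q] pays for the [4 * N] lost by summing the [y i] crudely, the other for the [Q] in
     the second term. *)
  have PE : P = (m * n) `^ ga * Q * Q.
    have mn0' : 0 < m * n by lra.
    rewrite /P /Q -!powRD_gt0 //.
    by congr powR; rewrite /al /be; field.
  rewrite PE.
  have h1 : u * n * Q * (4 * N) <= U * (m * n) `^ ga * Q * Q.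
    apply: ler_pM => //.
    - by rewrite !mulr_ge0 // ltW.
    - by rewrite mulr_ge0 // ltW.
    by rewrite ler_wpM2r.
  move: h1; set g := (m * n) `^ ga; lra.
rewrite /edge_bound -/al -/be -/U -/P -/Q big_split /=.
have T3 : u * (m + n) <= u * (m + n) * Q.
  by rewrite ler_peMr // mulr_ge0 ?addr_ge0 ?(ltW u0) ?(ltW m0) ?(ltW n0).
have UP0 : 0 <= U * P by apply: mulr_ge0.
have X0 : 0 <= u * (m + n).
  by rewrite mulr_ge0 ?addr_ge0 ?(ltW u0) ?(ltW m0) ?(ltW n0).
lra.
Qed.

End Numerics.

(** This isolates what the recursion needs from the geometry, so that it can be assumed for a
    relation and for its transpose. *)
Definition shrinking_step (I J : finType) (e : I -> J -> bool)
    (c N M L u : nat) : Prop :=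
  forall (A : {set I}) (B : {set J}), (0 < #|A|)%N ->
  exists n (A' : 'I_n -> {set I}) (B' : 'I_n -> {set J}), (n <= N)%N /\
    [/\ forall k, (M * #|A' k| <= #|A|)%N,
        forall k, B' k \subset B,
        (\sum_k #|B' k| <= c * #|B|)%N &
        (#|edges e A B| <= \sum_k #|edges e (A' k) (B' k)| +
                           L * u * (#|A| + #|B|))%N].

Lemma card_edges_swap (I J : finType) (e : I -> J -> bool) A B :
  #|edges (fun j i => e i j) B A| = #|edges e A B|.
Proof.
pose sw (p : J * I) := (p.2, p.1).
have swI : injective sw by move=> [? ?] [? ?] [-> ->].
rewrite -(card_imset _ swI); congr #|pred_of_set _|.
apply/setP => -[i j]; rewrite inE; apply/imsetP/idP.
  move=> [[j' i']].
  by rewrite inE /= => /and3P[H1 H2 H3] [-> ->]; apply/and3P.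
move=> /= /and3P[H1 H2 H3].
by exists (j, i) => //; rewrite inE; apply/and3P.
Qed.

Lemma card_edges_le (I J : finType) (e : I -> J -> bool) A B :
  (#|edges e A B| <= #|A| * #|B|)%N.
Proof.
rewrite -cardsX; apply/subset_leq_card/subsetP => p.
by rewrite !inE => /and3P[-> ->].
Qed.

(** Induction on [#|A| + #|B|], always cutting with the smaller side, which shrinks strictly because
    [M > 1]. The recursion stops when a side is smaller than [u] or the product of the sizes is
    bounded; there the trivial bound suffices. *)
Lemma edges_le_edge_bound (R : realType) (ga ep : R) (c N M L : nat) :
  2^-1 <= ga -> 0 < ep -> ga + ep <= 1 -> (0 < N)%N -> (1 < M)%N ->
  (1 + c%:R) * M%:R^-1 `^ (ga + ep) * N%:R `^ (1 - (ga + ep)) <= 4^-1 ->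
  c%:R * M%:R^-1 `^ (ep / 2) <= 4^-1 ->
  exists2 K : R, 0 <= K &
  forall (I J : finType) (e : I -> J -> bool) (u : nat), (0 < u)%N ->
    shrinking_step e c N M L u ->
    shrinking_step (fun j i => e i j) c N M L u ->
    forall A B, #|edges e A B|%:R <=
      K * edge_bound ga ep u%:R #|A|%:R #|B|%:R.
Proof.
move=> ga2 ep0 al1 N0 M1 hc1 hc2.
(* [T] is the threshold above which [edge_bound_step] applies. In [K], the 1 serves the case of a
   side smaller than [u], [T] the case of a small product, and [4 * L] the cost of a step, paid from
   the gain of one quarter. *)
pose T : R := (4 * N%:R) `^ (ep / 2)^-1; pose K := 1 + T + 4 * L%:R.
have T0 : 0 <= T by apply: powR_ge0.
have L0 : 0 <= L%:R :> R by [].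
exists K => [|I J e u u0 st st' A B]; first by rewrite /K; lra.
have [k] := ubnP (#|A| + #|B|); elim: k => // k IH in I J e A B st st' *.
rewrite ltnS => Hk.
have u1 : 1 <= u%:R :> R by rewrite ler1n.
wlog AB : I J e A B st st' Hk / (#|A| <= #|B|)%N.
  move=> W; have [AB|BA] := leqP #|A| #|B|; first exact: W.
  rewrite edge_boundC -card_edges_swap; apply: W => //; last exact: ltnW.
  by rewrite addnC.
have bd0 : 0 <= K * edge_bound ga ep u%:R #|A|%:R #|B|%:R.
  by rewrite mulr_ge0 ?edge_bound_ge0 // /K; lra.
have [A0|A0] := posnP #|A|.
  have : (#|edges e A B| <= 0)%N.
    by rewrite (leq_trans (card_edges_le _ _ _)) // A0.
  by rewrite leqn0 => /eqP ->.
set m : R := #|B|%:R; set n : R := #|A|%:R.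
have n1 : 1 <= n by rewrite ler1n.
have nm : n <= m by rewrite ler_nat.
have mn1 : 1 <= m * n by rewrite mulr_ege1 // (le_trans n1).
set Q := (m * n) `^ (ep / 2).
have Q1 : 1 <= Q by rewrite -(powRr0 (m * n)) ler_powR //; lra.
have triv : #|edges e A B|%:R <= m * n.
  by rewrite -natrM ler_nat mulnC card_edges_le.
have second_ge : K * (u%:R * (m + n) * Q) <= K * edge_bound ga ep u%:R n m.
  rewrite edge_boundC ler_wpM2l //; first by rewrite /K; lra.
  by rewrite lerDr mulr_ge0 ?powR_ge0.
have umn : u%:R * (m + n) <= u%:R * (m + n) * Q.
  by rewrite ler_peMr // mulr_ge0 //; lra.
have umn1 : 1 <= u%:R * (m + n) by rewrite mulr_ege1 //; lra.
have [nu|un] := ltP n u%:R.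
  apply: le_trans second_ge; apply: (le_trans triv).
  apply: (@le_trans _ _ (u%:R * (m + n) * Q)); last first.
    by rewrite ler_peMl //; rewrite /K; lra.
  apply: le_trans umn; rewrite mulrC; apply: ler_pM => //; lra.
have [mnT|Tmn] := ltP (m * n) T.
  apply: le_trans second_ge; apply: (le_trans triv).
  apply: (@le_trans _ _ (K * 1)); first by rewrite mulr1 /K; lra.
  by apply: ler_wpM2l; rewrite /K; lra.
have hN : 4 * N%:R <= Q.
  have -> : 4 * N%:R = T `^ (ep / 2).
    by rewrite /T -powRrM mulVf ?powRr1 ?mulr_ge0 //; lra.
  by apply: powR_le => //; lra.
have [k' [A' [B' [kN [hA hB sB Hedges]]]]] := st A B A0.
have M0 : 0 < M%:R :> R by rewrite ltr0n (ltnW M1).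
have A'le v : #|A' v|%:R <= n / M%:R.
  by rewrite ler_pdivlMr // -natrM ler_nat mulnC.
have step : \sum_v edge_bound ga ep u%:R #|B' v|%:R #|A' v|%:R +
    4^-1 * (u%:R * (m + n)) <= edge_bound ga ep u%:R m n.
  apply: (@edge_bound_step R ga ep c%:R N%:R M%:R) => //.
  - by rewrite ltr0n.
  - by rewrite ler1n ltnW.
  - lra.
  - by rewrite ler_nat.
  - by move=> v; rewrite ler0n ler_nat subset_leq_card.
  - by rewrite -natr_sum -natrM ler_nat.
  by move=> v; rewrite ler0n A'le.
have IHv v : #|edges e (A' v) (B' v)|%:R <=
    K * edge_bound ga ep u%:R #|B' v|%:R #|A' v|%:R.
  rewrite edge_boundC; apply: IH => //; apply: leq_trans Hk.
  rewrite -addSn leq_add ?subset_leq_card // ltnNge.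
  apply: contraL (hA v) => AA'; rewrite -ltnNge.
  by apply: (leq_trans (ltn_Pmull M1 A0)); rewrite leq_mul2l AA' orbT.
apply: (@le_trans _ _ (\sum_v #|edges e (A' v) (B' v)|%:R +
  L%:R * (u%:R * (m + n)))).
  have -> : \sum_v #|edges e (A' v) (B' v)|%:R + L%:R * (u%:R * (m + n)) =
    (\sum_v #|edges e (A' v) (B' v)| + L * u * (#|A| + #|B|))%:R.
    by rewrite natrD natr_sum !natrM natrD mulrA (addrC m).
  by rewrite ler_nat.
rewrite edge_boundC.
apply: (@le_trans _ _ (\sum_v K * edge_bound ga ep u%:R #|B' v|%:R #|A' v|%:R +
  L%:R * (u%:R * (m + n)))).
  by rewrite lerD2r; apply: ler_sum => v _; apply: IHv.
rewrite -mulr_sumr.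
have K0 : 0 <= K by rewrite /K; lra.
have := ler_wpM2l K0 step.
rewrite mulrDr; apply: le_trans; rewrite lerD2l [leRHS]mulrA.
by apply: ler_wpM2r; rewrite /K; lra.
Qed.

(** * Choice of the sample size and the shrinking factor *)

Section CuttingParameters.
Local Open Scope nat_scope.

Lemma exists_pow2_gt_affine (A B z0 : nat) :
  exists w, z0 <= 2 ^ w /\ A * w + B < (2 ^ w).-1.
Proof.
pose v := 2 * A + B + 1 + z0.
have hv : v < 2 ^ v by rewrite ltn_expl.
have E : 2 ^ (2 * v) = 2 ^ v * 2 ^ v by rewrite mul2n -addnn expnD.
have h : v.+1 * v.+1 <= 2 ^ (2 * v) by rewrite E leq_mul.
exists (2 * v); split; first by rewrite /v in h *; nia.
have vA : v * (2 * A + B + 1) <= v * v by rewrite leq_mul2l orbC leq_addr.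
have v1 : 1 <= v by rewrite /v; lia.
have vB : B <= v * B by rewrite leq_pmull.
lia.
Qed.

(** That is, [(1 - 1/M) ^ M <= 1/2]. With [M = x + 1] it follows from Bernoulli's inequality for
    [(1 + 1/x) ^ n], which is [H] without fractions. *)
Lemma double_pred_expn_le M : 0 < M -> 2 * M.-1 ^ M <= M ^ M.
Proof.
case: M => // x _ /=.
have H n : x ^ n * (x + n) <= x.+1 ^ n * x.
  elim: n => [|n IH]; first by rewrite !expn0 addn0.
  rewrite !expnS; apply: (@leq_trans (x.+1 * (x ^ n * (x + n)))); last first.
    by rewrite -mulnA leq_mul2l IH orbT.
  rewrite [leqRHS]mulnCA [x * x ^ n]mulnC -mulnA leq_mul2l; apply/orP; right; nia.
have [->|x0] := posnP x; first by [].
rewrite -(leq_pmul2r x0); apply: leq_trans (H x.+1).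
by rewrite mulnAC mulnC leq_mul2l; apply/orP; right; lia.
Qed.

(** Of the [M * z] sample entries, [M * z.-1] form [z.-1] blocks of length [M], each gaining a
    factor 2; together they outweigh [T ^ D]. *)
Lemma sampling_parameters (D M T z : nat) :
  1 < M -> D <= M -> 0 < z -> T ^ D < 2 ^ z.-1 ->
  T ^ D * M.-1 ^ (M * z - D) < M ^ (M * z - D).
Proof.
move=> M1 DM z0 hT.
have -> : M * z - D = M * z.-1 + (M - D).
  by case: z z0 {hT} => // z _; rewrite mulnS /=; lia.
have M0 : 0 < M.-1 by lia.
rewrite !expnD mulnA.
apply: (@leq_trans (2 ^ z.-1 * M.-1 ^ (M * z.-1) * M.-1 ^ (M - D))).
  by rewrite !ltn_pmul2r ?expn_gt0 ?M0.
rewrite !expnM -expnMn; apply: leq_mul; last by apply: leq_expl; exact: leq_pred.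
by apply: leq_expl; apply: double_pred_expn_le; lia.
Qed.

End CuttingParameters.

(** Since [s * (1 - ga) = ga], the terms [q * ga] cancel in the exponent of [z] in the first
    contraction factor. What remains is [ga - q * ep - q.+1 * s * ep], at most -1 once
    [q * ep >= 4]. *)
Lemma exists_cutting_parameters (R : realType) (D s : nat) (ep : R) :
  let ga := s%:R / (s%:R + 1) in let c := (2 ^ D)%N in
  (0 < s)%N -> 0 < ep -> ga + ep <= 1 ->
  exists r M : nat, let N := (2 * (r + D * 2).+1 ^ s)%N in
    [/\ (1 < M)%N, ((r + D * 2) ^ D * M.-1 ^ (r - D) < M ^ (r - D))%N,
      (1 + c%:R) * M%:R^-1 `^ (ga + ep) * N%:R `^ (1 - (ga + ep)) <= 4^-1 &
      c%:R * M%:R^-1 `^ (ep / 2) <= 4^-1].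
Proof.
move=> ga c s0 ep0 al1.
pose q := (Num.bound (4 / ep)).+1.
have hq : 4 <= q%:R * ep.
  rewrite -ler_pdivrMr //; apply/ltW.
  apply: (lt_le_trans (archi_boundP _)); first by rewrite divr_ge0 // ltW.
  by rewrite ler_nat.
pose c1 := (2 * (D * 2 + 2) ^ s)%N.
pose z0 := (D + 4 * (1 + c) * c1 + 4 * c + 2)%N.
(* With [z = 2 ^ w], the number of position choices is at most [2] to this affine function of [w],
   and it has to stay below [2 ^ z.-1]. The bound [z0] outweighs the constants in the two
   contraction factors. *)
have [w [zw hw]] := exists_pow2_gt_affine (q.+1 * D) ((2 * D + 1) * D) z0.
set z := (2 ^ w)%N in zw hw.
have z2 : (2 <= z)%N by apply: leq_trans zw; rewrite /z0 leq_addl.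
have Dz : (D <= z)%N by apply: leq_trans zw; rewrite /z0; lia.
have zM : (z <= z ^ q)%N by rewrite expnS leq_pmulr // expn_gt0; lia.
have zr : 1 <= z%:R :> R by rewrite ler1n; lia.
have zr0 : 0 < z%:R :> R by lra.
have al0 : 0 <= ga + ep.
  by rewrite addr_ge0 ?(ltW ep0) // divr_ge0 ?addr_ge0.
have Mp x : (z ^ q)%:R^-1 `^ x = z%:R `^ (- (q%:R * x)) :> R.
  by rewrite natrX -powR_mulrn ?(ltW zr0) // -powR_inv1 ?powR_ge0 //
     -!powRrM mulN1r mulrN.
(* [z] is a power of two, [M = z^q] and [r = z^(q+1)], so that [N] is of order
   [z^((q+1)s)] and both contraction factors are [O(1/z)]. *)
exists (z ^ q * z)%N, (z ^ q)%N; split.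
- exact: leq_trans zM.
- apply: sampling_parameters; [exact: leq_trans zM|exact: leq_trans zM|lia|].
  apply: (@leq_ltn_trans ((2 ^ (2 * D + 1) * (z ^ q * z)) ^ D)%N).
    apply: leq_expl.
    have h1 : (2 * D + 1 <= 2 ^ (2 * D + 1))%N by apply/ltnW/ltn_expl.
    have h2 : (0 < z ^ q * z)%N by rewrite muln_gt0 expn_gt0; lia.
    apply: (@leq_trans ((2 * D + 1) * (z ^ q * z))%N); last first.
      by rewrite leq_mul2r h1 orbT.
    by rewrite mulnDl mul1n addnC leq_add2r mulnC leq_pmulr.
  rewrite -expnSr /z -expnM -expnD -expnM ltn_exp2l //.
  by apply: leq_ltn_trans hw; rewrite mulnDl; lia.
- rewrite Mp.
  have Np : (2 * (z ^ q * z + D * 2).+1 ^ s)%:R `^ (1 - (ga + ep)) <=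
      c1%:R * z%:R `^ (q.+1%:R * s%:R * (1 - (ga + ep))) :> R.
    apply: (@le_trans _ _ ((c1 * z ^ (q.+1 * s))%:R `^ (1 - (ga + ep)))).
      apply: powR_le; rewrite ?subr_ge0 // ler_nat /c1 -mulnA leq_mul2l /=.
      rewrite expnM -expnMn; apply: leq_expl; rewrite expnSr.
      have h2 : (0 < z ^ q * z)%N by rewrite muln_gt0 expn_gt0; lia.
      by rewrite mulnDl; nia.
    rewrite natrM powRM // natrX -powR_mulrn ?(ltW zr0) // -powRrM natrM.
    rewrite ler_wpM2r ?powR_ge0 // ler1_powR //; last by lra.
    by rewrite ler1n /c1 muln_gt0 expn_gt0; lia.
  set t := z%:R `^ _.
  apply: (@le_trans _ _ ((1 + c%:R) * t *
    (c1%:R * z%:R `^ (q.+1%:R * s%:R * (1 - (ga + ep)))))).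
    by rewrite ler_wpM2l // mulr_ge0 ?powR_ge0 ?addr_ge0.
  have -> : (1 + c%:R) * t *
      (c1%:R * z%:R `^ (q.+1%:R * s%:R * (1 - (ga + ep)))) =
     (1 + c%:R) * c1%:R *
      z%:R `^ (- (q%:R * (ga + ep)) + q.+1%:R * s%:R * (1 - (ga + ep))) :> R.
    by rewrite powRD_gt0 // -/t; ring.
  apply: (@le_trans _ _ ((1 + c%:R) * c1%:R * z%:R^-1)).
    rewrite ler_wpM2l ?mulr_ge0 ?addr_ge0 // -powR_inv1 ?(ltW zr0) // ler_powR //.
    have s1 : 1 <= s%:R :> R by rewrite ler1n.
    have gaE : ga * (s%:R + 1) = s%:R by rewrite /ga divfK // gt_eqF //; lra.
    have h3 : 4 * s%:R <= q%:R * ep * s%:R :> R by rewrite ler_wpM2r //; lra.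
    have h4 : ga <= 1 by lra.
    have h5 : q%:R * (ga * (s%:R + 1)) = q%:R * s%:R by rewrite gaE.
    have h6 : 0 <= ep * s%:R :> R by rewrite mulr_ge0 // ltW.
    rewrite -[q.+1]addn1 natrD; lra.
  have : (4 * (1 + c) * c1 <= z)%N.
    apply: leq_trans zw; rewrite /z0; lia.
  rewrite -(ler_nat R) !natrM natrD ler_pdivrMr //; lra.
rewrite Mp; apply: (@le_trans _ _ (c%:R * z%:R^-1)).
  rewrite ler_wpM2l // -[leRHS]powR_inv1 ?(ltW zr0) // ler_powR //; lra.
have : (4 * c <= z)%N by apply: leq_trans zw; rewrite /z0; lia.
rewrite -(ler_nat R) natrM ler_pdivrMr //; lra.
Qed.

(** Passes from the symmetric second term of [edge_bound] to separate powers: if [n] is the larger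
    number, then [m + n <= 2 * n] and [m * n <= n * n]. *)
Lemma add_mul_powR_le (R : realType) (ep eps m n : R) :
  0 < ep -> ep <= eps -> 1 <= m -> 1 <= n ->
  (m + n) * (m * n) `^ (ep / 2) <= 2 * (m `^ (1 + eps) + n `^ (1 + eps)).
Proof.
move=> ep0 epe; wlog mn : m n / m <= n => [H|] m1 n1.
  have [mn|nm] := leP m n; first exact: H.
  by rewrite (addrC m) (mulrC m) [X in _ <= 2 * X]addrC H // ltW.
have n0 : 0 < n by lra.
apply: (@le_trans _ _ (2 * n `^ (1 + eps))); last first.
  by rewrite ler_wpM2l // lerDr powR_ge0.
apply: (@le_trans _ _ (2 * n * n `^ ep)).
  apply: ler_pM; rewrite ?powR_ge0 //; [lra|lra|].
  have -> : n `^ ep = (n * n) `^ (ep / 2).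
    rewrite powRM ?(ltW n0) // -powRD_gt0 //; congr powR; lra.
  by apply: powR_le; [lra|rewrite mulr_ge0 //; lra|rewrite ler_wpM2r // ltW].
rewrite -mulrA ler_wpM2l // -[X in X * _]powRr1 ?(ltW n0) // -powRD_gt0 //.
by rewrite ler_powR // lerD2l.
Qed.

(** * Unit distances *)

Section Lift.
Variables (R : realType) (d : nat).
Implicit Types p q : 'rV[R]_d.

Definition normsq p : R := \sum_(i < d) p 0 i ^+ 2.

Definition lift_normal p : 'rV[R]_d.+1 := row_mx (const_mx (-1) : 'rV_1) (2 *: p).
Definition lift_offset p : R := normsq p - 1.
Definition lift_point q : 'cV[R]_d.+1 := col_mx (const_mx (normsq q) : 'cV_1) q^T.

Lemma slack_lift (I : finType) (f : I -> 'rV[R]_d) i q :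
  slack (fun i => lift_normal (f i)) (fun i => lift_offset (f i)) i
    (lift_point q) = 1 - edist (f i) q ^+ 2.
Proof.
rewrite /slack /dotp /lift_normal /lift_point (@mul_row_col _ 1 1 d 1) mxE.
rewrite /edist sqr_sqrtr; last by apply: sumr_ge0 => k _; apply: sqr_ge0.
rewrite mxE big_ord1 !mxE /lift_offset /normsq.
have -> : \sum_(k < d) (f i 0 k - q 0 k) ^+ 2 =
    \sum_(k < d) q 0 k ^+ 2 + \sum_(k < d) f i 0 k ^+ 2 -
    \sum_(k < d) (2 *: f i) 0 k * q^T k 0.
  by rewrite -big_split -sumrB; apply: eq_bigr => k _; rewrite !mxE /=; ring.
ring.
Qed.

Lemma edist_ge0 p q : 0 <= edist p q.
Proof. exact: sqrtr_ge0. Qed.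

Lemma edistC p q : edist p q = edist q p.
Proof.
rewrite /edist; congr Num.sqrt; apply: eq_bigr => i _.
by rewrite -sqrrN opprB.
Qed.

(** The bound 1 on all distances makes the lifted functions nonnegative, as [incidence_step]
    requires. *)
Lemma unit_distance_step (r M u : nat) (I J : finType)
    (e : I -> J -> bool) (f : I -> 'rV[R]_d) (g : J -> 'rV[R]_d) :
  let N := (2 * (r + d.+1 * 2).+1 ^ d.+1./2)%N in
  (0 < M)%N ->
  ((r + d.+1 * 2) ^ d.+1 * M.-1 ^ (r - d.+1) < M ^ (r - d.+1))%N ->
  (forall i j, edist (f i) (g j) <= 1) ->
  (forall i j, e i j = (edist (f i) (g j) == 1)) ->
  biclique_free e u ->
  shrinking_step e (2 ^ d.+1) N M (2 ^ N) u.
Proof.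
move=> N M0 hrM fg eE efree A B A0.
apply: (@incidence_step R d.+1 r M u I J (fun i => lift_normal (f i))
  (fun i => lift_offset (f i)) (fun j => lift_point (g j))) => //.
  by move=> i j; rewrite slack_lift subr_ge0 expr_le1 ?edist_ge0.
move=> i j; rewrite slack_lift subr_eq0 eq_sym eE.
by rewrite -[in RHS](expr1n _ 2) eqrXn2 ?edist_ge0.
Qed.

End Lift.

(** * From finite sets of points to finite types, and the final bound *)

Lemma biclique_freeC (I J : finType) (e : I -> J -> bool) u :
  biclique_free e u -> biclique_free (fun j i => e i j) u.
Proof. by move=> H A B AB; rewrite or_comm; apply: H => i j iA jB; apply: AB. Qed.

Local Open Scope fset_scope.

(** [Kuu_free] speaks of sets with exactly [u] points, so larger sides are first truncated by
    [take u]. *)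
Lemma biclique_free_of_Kuu_free (R : realType) (d u : nat)
    (P1 P2 : {fset 'rV[R]_d}) : Kuu_free u P1 P2 ->
  biclique_free (fun (p : P1) (q : P2) => edist (val p) (val q) == 1) u.
Proof.
move=> free A B AB; have [|uA] := ltnP #|A| u; first by left.
have [|uB] := ltnP #|B| u; first by right.
pose sub (P : {fset 'rV[R]_d}) (S : {set P}) : {fset 'rV[R]_d} :=
  [fset x in [seq val p | p <- take u (enum S)]].
have subE (P : {fset 'rV[R]_d}) (S : {set P}) : (u <= #|S|)%N ->
    [/\ sub P S `<=` P, #|` sub P S| = u &
      forall x, x \in sub P S -> exists2 p, p \in S & x = val p].
  move=> uS; have ex x : x \in sub P S -> exists2 p, p \in S & x = val p.
    rewrite in_fset => /mapP[p /mem_take]; rewrite mem_enum => pS ->.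
    by exists p.
  split=> //.
    by apply/fsubsetP => x /ex[p _ ->]; apply: valP.
  rewrite card_fseq undup_id ?size_map ?size_takel -?cardE //.
  by rewrite map_inj_uniq ?take_uniq ?enum_uniq //; apply: val_inj.
have [h1 h2 h3] := subE _ A uA; have [k1 k2 k3] := subE _ B uB.
case: free; exists (sub _ A), (sub _ B); split => //.
move=> a b /h3[p pA ->] /k3[q qB ->].
by apply/eqP/AB.
Qed.

Lemma card_unit_edges_le (R : realType) (d : nat) (P1 P2 : {fset 'rV[R]_d}) :
  (#|` unit_edges P1 P2| <=
   #|edges (fun (p : P1) (q : P2) => edist (val p) (val q) == 1%R) setT setT|)%N.
Proof.
set E := edges _ _ _.
pose t := [seq (val p.1, val p.2) | p : P1 * P2 <- enum E].
have -> : #|E| = size t by rewrite size_map cardE.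
apply: uniq_leq_size; first exact: fset_uniq.
move=> [p q]; rewrite in_fset /= inE in_fsetM /= => /andP[/andP[pP qP] pq].
apply/mapP; exists ([` pP], [` qP]) => //.
by rewrite mem_enum inE /= !inE.
Qed.

Theorem theorem1p12 (R : realType) (d : nat) (eps : R) (heps : 0 < eps) :
  exists C : R, forall (u : nat) (P1 P2 : {fset 'rV[R]_d}),
    has_diameter (P1 `|` P2) 1 ->
    Kuu_free u P1 P2 ->
    let m : R := (#|` P1|)%:R in
    let n : R := (#|` P2|)%:R in
    let s : R := ((d.+1)./2)%:R in
    (#|` unit_edges P1 P2|)%:R <=
      C * (powR (u%:R) (2 / (s + 1)) * powR (m * n) (s / (s + 1) + eps)
           + u%:R * powR m (1 + eps) + u%:R * powR n (1 + eps)).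
Proof.
(* For [d = 0] all distances are 0, so the diameter cannot be 1. Otherwise [s] is positive. *)
have [d0|d0] := posnP d.
  exists 0 => u P1 P2 [_ [p [q [_ _]]]] + _; rewrite /edist.
  rewrite big1 => [|[i hi] _]; last by exfalso; move: hi; rewrite d0.
  by rewrite sqrtr0 => /eqP; rewrite eq_sym oner_eq0.
set s := d.+1./2.
have s0 : (0 < s)%N by rewrite /s; lia.
have s1 : 1 <= s%:R :> R by rewrite ler1n.
pose ga : R := s%:R / (s%:R + 1).
have gaE : 1 - ga = (s%:R + 1)^-1 by rewrite /ga; field; lra.
have ga1 : 0 < 1 - ga by rewrite gaE invr_gt0; lra.
have ga2 : 2^-1 <= ga by rewrite /ga ler_pdivlMr; lra.
(* The cap at [1 - ga] keeps the exponent [ga + ep] at most 1, as the summation of powers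
   requires. *)
pose ep := Num.min eps (1 - ga).
have ep0 : 0 < ep by rewrite lt_min heps ga1.
have epe : ep <= eps by rewrite ge_min lexx.
have al1 : (ga + ep <= 1)%R.
  have : ep <= 1 - ga by rewrite ge_min lexx orbT.
  lra.
have [r [M [M1 hrM hc1 hc2]]] :=
  @exists_cutting_parameters R d.+1 s ep s0 ep0 al1.
set N := (2 * _)%N in hc1.
have N0 : (0 < N)%N by rewrite /N muln_gt0 expn_gt0.
have [K K0 HK] :=
  @edges_le_edge_bound R ga ep _ N M (2 ^ N) ga2 ep0 al1 N0 M1 hc1 hc2.
exists (2 * K) => u P1 P2 [diam _] free; cbv zeta.
set m : R := (#|` P1|)%:R; set n : R := (#|` P2|)%:R.
(* Two empty sets form a biclique with [u = 0], so [Kuu_free] excludes this value. *)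
have u0 : (0 < u)%N.
  case: u free => // free; exfalso; apply: free; exists fset0, fset0.
  by split; rewrite ?fsub0set ?cardfs0.
pose e (p : P1) (q : P2) := edist (val p) (val q) == 1.
have efree : biclique_free e u by apply: biclique_free_of_Kuu_free.
have dist1 (p : P1) (q : P2) : edist (val p) (val q) <= 1.
  by apply: diam; rewrite in_fsetU ?(valP p) ?(valP q) ?orbT.
have st : shrinking_step e (2 ^ d.+1) N M (2 ^ N) u.
  by apply: (@unit_distance_step _ _ r M u P1 P2 e val val) => //; apply: ltnW.
have st' : shrinking_step (fun q p => e p q) (2 ^ d.+1) N M (2 ^ N) u.
  apply: (@unit_distance_step _ _ r M u P2 P1 _ val val) => //; first exact: ltnW.
  - by move=> q p; rewrite edistC.
  - by move=> q p; rewrite edistC.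
  exact: biclique_freeC.
have Hedges : (#|` unit_edges P1 P2|)%:R <= K * edge_bound ga ep u%:R m n.
  apply: (@le_trans _ _ #|edges e setT setT|%:R).
    by rewrite ler_nat card_unit_edges_le.
  by apply: le_trans (HK _ _ e u u0 st st' _ _) _; rewrite !cardsT -!cardfE.
apply: (le_trans Hedges); rewrite [2 * K]mulrC -mulrA ler_wpM2l //.
have u00 : 0 <= u%:R :> R by [].
have -> : 2 / (s%:R + 1) = 2 * (1 - ga) by rewrite gaE.
have -> : s%:R / (s%:R + 1) = ga by [].
rewrite /edge_bound; set U := u%:R `^ _; have U0 : 0 <= U by apply: powR_ge0.
(* Monotonicity of powers in the exponent needs bases at least 1, so an empty side is treated
   separately. *)
have [mn0|mn0] := eqVneq (m * n) 0.
  have z0 (p : R) : 0 < p -> (m * n) `^ p = 0.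
    by move=> p0; rewrite mn0 powR0 // gt_eqF.
  rewrite (z0 (ga + ep)%R) ?(z0 (ga + eps)%R) ?(z0 (ep / 2)); [|lra..].
  by rewrite !mulr0 !add0r mulr_ge0 // addr_ge0 ?mulr_ge0 ?powR_ge0.
have [m1 n1] : 1 <= m /\ 1 <= n.
  move: mn0; rewrite mulf_eq0 negb_or !pnatr_eq0 -!lt0n => /andP[? ?].
  by rewrite !ler1n.
have mn1 : 1 <= m * n by rewrite mulr_ege1.
have h1 : U * (m * n) `^ (ga + ep) <= U * (m * n) `^ (ga + eps).
  by rewrite ler_wpM2l // ler_powR // lerD2l.
have h2 : 0 <= U * (m * n) `^ (ga + eps) by rewrite mulr_ge0 ?powR_ge0.
have := ler_wpM2l u00 (@add_mul_powR_le R ep eps m n ep0 epe m1 n1).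
rewrite -mulrA; move: h1 h2; clear; lra.
Qed.
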